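(* There exists a subshift $X\subseteq\{0,1\}^{\mathbb{Z}}$ such that the $\mathbb{Z}$-system $(X,\sigma)$ is chaotic almost minimal (CAM), and $(X,\sigma)$ supports at least two distinct nonatomic ergodic $\sigma$-invariant Borel probability measures.
   Context: Let $G$ be a countable discrete group. A topological $G$-system $(X,T)$ consists of a compact metric space $X$ and an action $T\colon G\to\mathrm{Homeo}(X)$, $g\mapsto T_g$. A $\mathbb{Z}$-system is given by a single homeomorphism $T$ (with $T_n=T^n$). The system is topologically transitive if for all nonempty open $U,V\subseteq X$ there is $g\in G$ with $T_gU\cap V\neq\emptyset$; the action is faithful if $T_g=\mathrm{id}_X$ only when $g$ is the identity. A point is periodic if its $G$-orbit is finite. The system is chaotic almost minimal (CAM) if: (1) it is topologically transitive and the action is faithful; (2) the periodic points are dense in $X$; (3) every proper closed $T$-invariant subset of $X$ is finite. A subshift is a closed subset $X\subseteq\{0,1\}^{\mathbb{Z}}$ invariant under the left shift $(\sigma x)_n=x_{n+1}$, with the product topology. *)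

(* Defs.v *)
From HB Require Import structures.
From mathcomp Require Import all_boot all_order all_algebra.
From mathcomp Require Import all_classical all_reals all_analysis.
Set Implicit Arguments. Unset Strict Implicit. Unset Printing Implicit Defensive.
Import Order.TTheory GRing.Theory Num.Theory.
Local Open Scope classical_set_scope.
Local Open Scope ring_scope.

Definition Cantor : topologicalType := {ptws int -> bool}.

Definition BorelCantor := g_sigma_algebraType (@open Cantor).

Definition shift (x : Cantor) : Cantor := fun n => x (n + 1).

Definition shiftn (k : int) (x : Cantor) : Cantor := fun n => x (n + k).

Definition subshift (X : set Cantor) : Prop := closed X /\ shift @` X = X.

Definition open_in (X U : set Cantor) : Prop :=
  exists U' : set Cantor, open U' /\ U = X `&` U'.

Definition top_transitive (X : set Cantor) : Prop :=
  forall U V : set Cantor, open_in X U -> open_in X V ->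
    U !=set0 -> V !=set0 -> exists k : int, (shiftn k @` U) `&` V !=set0.

Definition faithful_on (X : set Cantor) : Prop :=
  forall k : int, (forall x, X x -> shiftn k x = x) -> k = 0.

Definition periodic (x : Cantor) : Prop :=
  finite_set (range (fun k : int => shiftn k x)).

Definition invariant_set (A : set Cantor) : Prop :=
  forall k : int, shiftn k @` A `<=` A.

Definition CAM (X : set Cantor) : Prop :=
  [/\ top_transitive X /\ faithful_on X,
      X `<=` closure (X `&` periodic) &
      forall A : set Cantor, A `<=` X -> A <> X -> closed A ->
        invariant_set A -> finite_set A].

(* Borel probability measures on X are identified with Borel probability
   measures on the full shift giving full measure to X. *)
Definition supported_on (R : realType) (mu : probability BorelCantor R)
  (X : set Cantor) : Prop := mu X = 1%E.

Definition shift_invariant_measure (R : realType)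
  (mu : probability BorelCantor R) : Prop :=
  forall A : set BorelCantor, measurable A ->
    mu (shift @^-1` A) = mu A.

Definition ergodic (R : realType) (mu : probability BorelCantor R) : Prop :=
  shift_invariant_measure mu /\
  forall A : set BorelCantor, measurable A -> shift @^-1` A = A ->
    mu A = 0%E \/ mu A = 1%E.

Definition nonatomic (R : realType) (mu : probability BorelCantor R) : Prop :=
  forall x : BorelCantor, mu [set x] = 0%E.

(* Main.v *)
(** Let [x_0 = 0^Z], [x_1 = 1^Z] and let [x_{m+2}] ([perpt m.+2] below) be a
periodic sequence obtained by concatenating aligned blocks of length [h_{m+1}]
([height m.+1]), each block being a piece of one of [x_0, ..., x_{m+1}]: almost
all of them are pieces of [x_m], but every earlier [x_n] occurs, and two adjacent
blocks that are not [x_{m+1}]-blocks have the same index.  The subshift [X] is the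
closure of the orbits of the [x_n].  By the adjacency rule a long window of [x_m]
is either a window of some [x_n] with [n < N] or meets a full period of [x_N]; so
a point of [X] outside the orbits of the [x_n], [n < N], contains a full period of
[x_N], hence all short words of [X], and an infinite closed invariant subset must
be [X].

The periods [h_m] are powers of 2, so the [x_m] are functions of the phase
mod [h_m] of a point of the dyadic odometer.  For a fixed parity of [m] the values
[x_m(phase + i)] are Haar-almost surely eventually constant (Borel-Cantelli, as
[x_{m+2}] mostly copies [x_m]), and their limit is an equivariant map from the
odometer to [X].  The two parities push the ergodic Haar measure to the two
required measures: one lives mostly on zeros, the other mostly on ones. *)

Require Import Defs.
From HB Require Import structures.
From mathcomp Require Import zify lra.
From mathcomp Require Import all_boot all_order all_algebra.
From mathcomp Require Import all_classical all_reals all_analysis.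
Set Implicit Arguments. Unset Strict Implicit. Unset Printing Implicit Defensive.
Import Order.TTheory GRing.Theory Num.Theory.
Local Open Scope classical_set_scope.
Local Open Scope ring_scope.

(** * The periodic points and their block structure *)

Definition height (m : nat) : nat := (2 ^ (m.+1 ^ 2))%N.
Definition ratio (m : nat) : nat := (2 ^ (m.*2 + 5))%N.

Lemma height_gt0 m : (0 < height m)%N. Proof. by rewrite expn_gt0. Qed.

Lemma heightSS m : height m.+2 = (height m.+1 * ratio m)%N.
Proof. by rewrite /height /ratio -expnD; congr (_ ^ _)%N; lia. Qed.

Lemma dvdn_height n m : (n <= m)%N -> (height n %| height m)%N.
Proof. by move=> nm; apply: dvdn_exp2l; rewrite leq_exp2r. Qed.

Lemma leq_height n m : (n <= m)%N -> (height n <= height m)%N.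
Proof. by move=> nm; rewrite leq_exp2l// leq_exp2r. Qed.

Lemma ltn_height m : (m < height m)%N.
Proof.
apply: (@leq_trans (2 ^ m.+1)); first exact: (leq_trans _ (ltn_expl _ _)).
by rewrite leq_exp2l// -{1}(expn1 m.+1) leq_pexp2l.
Qed.

Lemma ratio_gt m : (m.*2 + 4 < ratio m)%N.
Proof. by have := ltn_expl (m.*2 + 5) (ltnSn 1); rewrite /ratio; lia. Qed.

(* Index of the [t]-th block of [perpt m.+2]; the values other than [m] serve only to
   begin and end the period with [m.+1] and to exhibit each [n < m] once,
   surrounded by [m.+1]-blocks. *)
Definition letter (m t : nat) : nat :=
  if t == (ratio m).-1 then m.+1
  else if odd t then minn t./2 m
  else if (t <= m.*2)%N then m.+1 else m.

Lemma letter_le m t : (letter m t <= m.+1)%N.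
Proof.
by rewrite /letter; case: eqP => // _; case: ifP => _; [lia|case: ifP; lia].
Qed.

Lemma letter0 m : letter m 0 = m.+1.
Proof.
by rewrite /letter; case: eqP => //= H; have := ratio_gt m; lia.
Qed.

Lemma letter_last m : letter m (ratio m).-1 = m.+1.
Proof. by rewrite /letter eqxx. Qed.

Lemma letter_odd m n : (n <= m)%N -> letter m n.*2.+1 = n.
Proof.
move=> nm; rewrite /letter; case: eqP => [|_]; first by have := ratio_gt m; lia.
by rewrite /= odd_double /= uphalf_double; lia.
Qed.

Lemma letter_adj m t : (t.+1 < ratio m)%N ->
  (letter m t <= m)%N -> (letter m t.+1 <= m)%N -> letter m t = letter m t.+1.
Proof.
rewrite /letter => tq; case: eqP => [|_]; first by lia.
case: eqP => [|_]; first by lia.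
by case: ifP => ot; case: ifP => ot'; try case: ifP; try case: ifP; lia.
Qed.

Definition digit (m : nat) (i : int) : nat :=
  absz (modz (divz i (height m.+1)%:Z) (ratio m)%:Z).

Lemma ratio_gt0 m : (0 < ratio m)%N. Proof. by rewrite expn_gt0. Qed.

Lemma digitE m i :
  (digit m i)%:Z = (modz (divz i (height m.+1)%:Z) (ratio m)%:Z).
Proof. by rewrite /digit gez0_abs// modz_ge0// eqz_nat -lt0n ratio_gt0. Qed.

Lemma digit_lt m i : (digit m i < ratio m)%N.
Proof. by rewrite -ltz_nat digitE ltz_pmod// ltz_nat ratio_gt0. Qed.

Lemma divz_range (d : nat) (s i : int) : (0 < d)%N ->
  s * d%:Z <= i -> i < (s + 1) * d%:Z -> (i %/ d%:Z)%Z = s.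
Proof.
move=> d0 h1 h2; have d0' : 0 < d%:Z by rewrite ltz_nat.
apply/eqP; rewrite eq_le; apply/andP; split.
  by rewrite -ltzD1 ltz_divLR.
by rewrite lez_divRL.
Qed.

Lemma divz_bounds (d : nat) (i : int) : (0 < d)%N ->
  (i %/ d%:Z)%Z * d%:Z <= i /\ i < ((i %/ d%:Z)%Z + 1) * d%:Z.
Proof.
move=> d0; have d0' : 0 < d%:Z by rewrite ltz_nat.
by rewrite lez_floor ?gt_eqF// ltz_ceil.
Qed.

(* Unfold the index [m] at position [i] until it is at most [N]; the second argument
   is fuel. *)
Fixpoint desc_rec (N f m : nat) (i : int) : nat :=
  if (m <= N)%N then m
  else if f is f'.+1 then desc_rec N f' (letter m.-2 (digit m.-2 i)) i else m.

Arguments desc_rec : simpl never.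

Definition desc N m i := desc_rec N m m i.

Definition perpt (m : nat) : Cantor := fun i => odd (desc 1 m i).

Lemma desc_recS N f m i : desc_rec N f.+1 m i =
  if (m <= N)%N then m else desc_rec N f (letter m.-2 (digit m.-2 i)) i.
Proof. by []. Qed.

Lemma desc_rec_fuel N f m i : (0 < N)%N -> (m <= f)%N ->
  desc_rec N f m i = desc N m i.
Proof.
move=> N0; rewrite /desc; elim/ltn_ind: f m => -[|f] IH m.
  by rewrite leqn0 => /eqP ->.
case: m => [|[|m]] mf; rewrite ?desc_recS ?leq0n ?N0//.
case: (leqP m.+2 N) => // mN /=.
have := letter_le m (digit m i) => lm.
rewrite [LHS]IH//; last by lia.
by symmetry; apply: (IH m.+1).
Qed.

Lemma desc_small N m i : (m <= N)%N -> desc N m i = m.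
Proof. by rewrite /desc; case: m => [|m] //; rewrite desc_recS => ->. Qed.

Lemma descSS N m i : (0 < N)%N -> (N < m.+2)%N ->
  desc N m.+2 i = desc N (letter m (digit m i)) i.
Proof.
move=> N0 Nm; rewrite {1}/desc desc_recS leqNgt Nm /= desc_rec_fuel//.
exact: letter_le.
Qed.

Lemma desc_ind N (P : nat -> Prop) : (0 < N)%N ->
  (forall m, (m <= N)%N -> P m) ->
  (forall m, (N < m.+2)%N -> (forall k, (k <= m.+1)%N -> P k) -> P m.+2) ->
  forall m, P m.
Proof.
move=> N0 h1 h2; elim/ltn_ind => -[|[|m]] IH; [exact: h1|exact: h1|].
by have [mN|mN] := leqP m.+2 N; [exact: h1|exact: h2].
Qed.

Lemma desc_le N m i : (0 < N)%N -> (desc N m i <= N)%N.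
Proof.
move=> N0; move: m; apply: (desc_ind N0) => m mN; first by rewrite desc_small.
by move=> IH; rewrite descSS// IH// letter_le.
Qed.

Lemma perptSS m i : perpt m.+2 i = perpt (letter m (digit m i)) i.
Proof. by rewrite /perpt descSS. Qed.

Lemma perpt_desc N m i : (0 < N)%N -> perpt m i = perpt (desc N m i) i.
Proof.
move=> N0; move: m; apply: (desc_ind N0) => m mN; first by rewrite desc_small.
by move=> IH; rewrite perptSS descSS// IH// letter_le.
Qed.

Lemma height_divz n m : (n <= m)%N -> exists2 c : nat, (0 < c)%N & height m = (height n * c)%N.
Proof.
move=> /dvdn_height/dvdnP[c cE]; exists c; last by rewrite mulnC.
by rewrite lt0n; apply/eqP => c0; have := height_gt0 m; rewrite cE c0.
Qed.

Lemma digit_block N m i j : (N <= m.+1)%N ->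
  (i %/ (height N)%:Z = j %/ (height N)%:Z)%Z -> digit m i = digit m j.
Proof.
move=> /height_divz[c c0 hE] ij; apply/eqP; rewrite -eqz_nat !digitE hE PoszM.
by rewrite !divzMA_ge0// ij.
Qed.

Lemma desc_block N m i j : (0 < N)%N ->
  (i %/ (height N)%:Z = j %/ (height N)%:Z)%Z -> desc N m i = desc N m j.
Proof.
move=> N0 ij; move: m; apply: (desc_ind N0) => m mN; first by rewrite !desc_small.
move=> IH; rewrite !descSS//; have -> : digit m j = digit m i.
  by apply/esym/(digit_block _ ij); lia.
by rewrite IH// letter_le.
Qed.

Lemma digit_mul m s : digit m (s * (height m.+2)%:Z) = 0%N.
Proof.
apply/eqP; rewrite -eqz_nat digitE heightSS PoszM mulrA mulrAC mulzK; last first.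
  by rewrite eqz_nat -lt0n height_gt0.
by rewrite modzMl.
Qed.

Lemma digit_mul_pred m s : digit m (s * (height m.+2)%:Z - 1) = (ratio m).-1.
Proof.
have q0 := ratio_gt0 m; have h0 := height_gt0 m.+1.
apply/eqP; rewrite -eqz_nat digitE.
rewrite (@divz_range _ (s * (ratio m)%:Z - 1))//; first last.
- by rewrite subrK heightSS PoszM -mulrA (mulrC (Posz (ratio m))); lia.
- by rewrite heightSS PoszM mulrBl -mulrA (mulrC (Posz (ratio m))); lia.
have -> : s * (ratio m)%:Z - 1 = (s - 1) * (ratio m)%:Z + (ratio m).-1%:Z by lia.
by rewrite modzMDl modz_small//; lia.
Qed.

Lemma desc_end N m s : (0 < N)%N -> (N <= m)%N ->
  desc N m (s * (height m)%:Z) = N /\ desc N m (s * (height m)%:Z - 1) = N.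
Proof.
move=> N0; elim: m s => [|m IH] s; first by rewrite leqNgt N0.
rewrite leq_eqVlt => /orP[/eqP <-|Nm]; first by rewrite !desc_small.
case: m Nm IH => [|m] Nm IH; first by lia.
have := IH (s * (ratio m)%:Z); rewrite -ltnS Nm => /(_ isT).
rewrite -mulrA -PoszM (mulnC (ratio m)) -heightSS => -[h1 h2].
by rewrite !descSS// digit_mul digit_mul_pred letter0 letter_last.
Qed.

Lemma desc_adj N m i : (0 < N)%N ->
  (desc N m i < N)%N -> (desc N m (i + 1) < N)%N -> desc N m i = desc N m (i + 1).
Proof.
move=> N0; move: m; apply: (desc_ind N0) => m mN; first by rewrite !desc_small.
move=> IH; rewrite !descSS//.
have h0 := height_gt0 m.+1; have q0 := ratio_gt0 m.
have [ii|ii] := eqVneq (i %/ (height m.+1)%:Z)%Z ((i + 1) %/ (height m.+1)%:Z)%Z.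
  have -> : digit m (i + 1) = digit m i by apply/esym/(digit_block _ ii); lia.
  by apply: IH; exact: letter_le.
set s := (i %/ _)%Z in ii; have [si is1] := divz_bounds i h0; rewrite -/s in si is1.
have iE : i + 1 = (s + 1) * (height m.+1)%:Z.
  apply/eqP; rewrite eq_le; apply/andP; split; first by lia.
  rewrite leNgt; apply/negP => lt_i; move/eqP: ii; apply.
  by rewrite (@divz_range _ s)//; lia.
have E1 : ((i + 1) %/ (height m.+1)%:Z)%Z = s + 1.
  by rewrite iE mulzK// eqz_nat -lt0n.
have [H1|H1] := leqP N (letter m (digit m i)).
  have := @desc_end N (letter m (digit m i)).
  have [c c0 cE] := height_divz (letter_le m (digit m i)).
  move=> /(_ ((s + 1) * c%:Z) N0 H1)[_].
  by rewrite -mulrA -PoszM (mulnC c) -cE -iE addrK => ->; rewrite ltnn.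
have [H2|H2] := leqP N (letter m (digit m (i + 1))).
  have := @desc_end N (letter m (digit m (i+1))).
  have [c c0 cE] := height_divz (letter_le m (digit m (i+1))).
  move=> /(_ ((s + 1) * c%:Z) N0 H2)[+ _].
  by rewrite -mulrA -PoszM (mulnC c) -cE -iE => ->; rewrite ltnn.
move=> _ _; have d1 : (digit m i < (ratio m).-1)%N.
  have := digit_lt m i; rewrite -{1}(prednK q0) ltnS leq_eqVlt => /orP[/eqP dE|//].
  by move: H1; rewrite dE letter_last; lia.
have dE : digit m (i + 1) = (digit m i).+1.
  apply/eqP; rewrite -eqz_nat digitE E1 -addn1 PoszD digitE -/s -modzDml modz_small//.
  by rewrite -digitE; lia.
by rewrite (desc_small _ (ltnW H1)) (desc_small _ (ltnW H2)) dE letter_adj// -?dE; lia.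
Qed.

Lemma desc_const N m a (l : nat) : (0 < N)%N ->
  (forall i : nat, (i < l)%N -> (desc N m (a + i%:Z) < N)%N) ->
  forall i : nat, (i < l)%N -> desc N m (a + i%:Z) = desc N m a.
Proof.
move=> N0 H; elim => [|i IH] il; first by rewrite addr0.
rewrite -IH; last by lia.
have -> : a + i.+1%:Z = a + i%:Z + 1 by lia.
apply/esym/desc_adj => //; first by apply: H; lia.
by have := H _ il; have -> : a + i.+1%:Z = a + i%:Z + 1 by lia.
Qed.

Lemma perpt_period n m i k : (n <= m)%N -> perpt n (i + k * (height m)%:Z) = perpt n i.
Proof.
move: n m k; apply: (desc_ind (ltnSn 0)) => n.
  by move=> n1 m k nm; rewrite /perpt !desc_small.
move=> _ IH m k nm; rewrite !perptSS.
have -> : digit n (i + k * (height m)%:Z) = digit n i.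
  have [c c0 cE] := height_divz nm.
  have -> : k * (height m)%:Z = (k * c%:Z * (ratio n)%:Z) * (height n.+1)%:Z.
    by rewrite cE heightSS !PoszM; lia.
  apply/eqP; rewrite -eqz_nat !digitE addrC divzMDl ?eqz_nat -?lt0n ?height_gt0//.
  by rewrite modzMDl.
by apply: IH; have := letter_le n (digit n i); lia.
Qed.

Lemma perpt_block n m i : (n <= m)%N ->
  n.*2.+1%:Z * (height m.+1)%:Z <= i -> i < n.*2.+2%:Z * (height m.+1)%:Z ->
  perpt m.+2 i = perpt n i.
Proof.
move=> nm h1 h2; rewrite perptSS.
suff -> : digit m i = n.*2.+1 by rewrite letter_odd.
apply/eqP; rewrite -eqz_nat digitE (@divz_range _ n.*2.+1%:Z) ?height_gt0//.
  by rewrite modz_small//; have := ratio_gt m; lia.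
by have -> : n.*2.+1%:Z + 1 = n.*2.+2%:Z by lia.
Qed.

Lemma perpt_appear n a (l : nat) : exists M, forall N, (M <= N)%N ->
  exists b : int, [/\ 0 <= b, b + l%:Z <= (height N)%:Z &
    forall i : nat, (i < l)%N -> perpt N (b + i%:Z) = perpt n (a + i%:Z)].
Proof.
exists (n + height n + l).+2 => -[|[|m]]// mM.
have lm : (height n + l <= height m.+1)%N by have := ltn_height m.+1; lia.
have h0 := height_gt0 n; have h0' : 0 < (height n)%:Z by rewrite ltz_nat.
have nm : (n <= m)%N by lia.
have nm' : (n <= m.+1)%N by lia.
have [c c0 cE] := height_divz nm'.
have r0 : 0 <= (a %% (height n)%:Z)%Z by rewrite modz_ge0// gt_eqF.
have r1 := ltz_pmod a h0'.
exists (n.*2.+1%:Z * (height m.+1)%:Z + (a %% (height n)%:Z)%Z); split.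
- by lia.
- have le1 : (n.*2.+2 * height m.+1 <= height m.+2)%N.
    by rewrite heightSS mulnC leq_mul2l; have := ratio_gt m; lia.
  apply: (@le_trans _ _ (n.*2.+2 * height m.+1)%:Z); last by rewrite lez_nat.
  by lia.
- move=> i il; rewrite (@perpt_block n)//; [|by lia|by lia].
  rewrite -[RHS](@perpt_period _ n _ (n.*2.+1%:Z * c%:Z - (a %/ (height n)%:Z)%Z))//.
  congr (perpt n _); rewrite cE PoszM; have := divz_eq a (height n)%:Z.
  by move: (divz a _) (modz a _) => u v ->; lia.
Qed.

Lemma perpt_window N m a (l : nat) : (0 < N)%N ->
  (exists2 n, (n < N)%N &
     forall i : nat, (i < l)%N -> perpt m (a + i%:Z) = perpt n (a + i%:Z)) \/
  (exists c : int, [/\ a - (height N)%:Z <= c, c < a + l%:Z &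
     forall i : nat, (i < height N)%N -> perpt m (c + i%:Z) = perpt N i%:Z]).
Proof.
move=> N0; have [[i il dN]|nex] :=
  pselect (exists2 i : nat, (i < l)%N & desc N m (a + i%:Z) = N).
  right; have h0 := height_gt0 N; have [b1 b2] := divz_bounds (a + i%:Z) h0.
  set s := divz (a + i%:Z) _ in b1 b2.
  exists (s * (height N)%:Z); split; [lia|lia|] => j jh.
  rewrite (perpt_desc m _ N0) (@desc_block N m _ (a + i%:Z))//.
    by rewrite dN addrC perpt_period.
  by rewrite (@divz_range _ s)//; lia.
left; case: l nex => [|l] nex; first by exists 0%N.
have dlt i : (i < l.+1)%N -> (desc N m (a + i%:Z) < N)%N.
  by move=> il; rewrite ltn_neqAle desc_le// andbT; apply/eqP => dN; apply: nex; exists i.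
exists (desc N m a); first by have := dlt 0%N isT; rewrite addr0.
by move=> i il; rewrite (perpt_desc m _ N0) (desc_const N0 dlt).
Qed.

Definition orbit_closure : set Cantor :=
  [set y | forall (a : int) (l : nat), exists n (b : int),
     forall i : nat, (i < l)%N -> y (a + i%:Z) = perpt n (b + i%:Z)].

Lemma orbit_closure_shift k y : orbit_closure y -> orbit_closure (shiftn k y).
Proof.
move=> Xy a l; have [n [b H]] := Xy (a + k) l; exists n, b => i il.
by rewrite -H//; rewrite /shiftn; congr y; lia.
Qed.

Lemma orbit_closure_perpt n k : orbit_closure (shiftn k (perpt n)).
Proof.
by apply: orbit_closure_shift => a l; exists n, a.
Qed.

Lemma shiftnD j k (y : Cantor) : shiftn j (shiftn k y) = shiftn (j + k) y.
Proof. by apply/funext => i; rewrite /shiftn addrA. Qed.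

Lemma shiftn0 (y : Cantor) : shiftn 0 y = y.
Proof. by apply/funext => i; rewrite /shiftn addr0. Qed.

Lemma perpt_modz n (k : int) :
  exists2 j : nat, (j < height n)%N & forall i, perpt n (i + k) = perpt n (i + j%:Z).
Proof.
have h0 : 0 < (height n)%:Z by rewrite ltz_nat height_gt0.
have r0 : 0 <= modz k (height n)%:Z by rewrite modz_ge0// gt_eqF.
have r1 := ltz_pmod k h0.
exists (absz (modz k (height n)%:Z)); first by rewrite -ltz_nat gez0_abs.
move=> i; rewrite gez0_abs// {1}(divz_eq k (height n)%:Z) addrCA addrC.
by rewrite perpt_period.
Qed.

Lemma orbit_closure_contains y N : orbit_closure y -> (0 < N)%N ->
  (forall n k, (n < N)%N -> y <> shiftn k (perpt n)) ->
  exists c : int, forall i : nat, (i < height N)%N -> y (c + i%:Z) = perpt N i%:Z.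
Proof.
move=> Xy N0 yN.
have [j jP] : {j : nat * nat -> int & forall p, (p.1 < N)%N ->
    y (j p) != perpt p.1 (j p + p.2%:Z)}.
  apply: (@boolp.choice _ _ (fun p z => (p.1 < N)%N ->
    y z != perpt p.1 (z + p.2%:Z))) => -[n k] /=.
  have [nN|_] := boolP (n < N)%N; last by exists 0.
  have [//|H] := pselect (exists i, y i != perpt n (i + k%:Z)).
    by case=> i Hi; exists i.
  exfalso; apply: (yN n k%:Z nN); apply/funext => i.
  by apply/eqP; apply: contra_notT H => Hi; exists i.
pose M := (\max_(n < N) \max_(k < height n) absz (j (nat_of_ord n, nat_of_ord k)))%N.
have jM n k : (n < N)%N -> (k < height n)%N -> (absz (j (n, k)) <= M)%N.
  move=> nN kh; apply: leq_trans (leq_bigmax (Ordinal nN)).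
  exact: (leq_bigmax (Ordinal kh)).
pose h := height N.
have [m [b H]] := Xy (- (M + h)%:Z) (M + M + h + h).+1.
have [[n nN Hn]|[c [c1 c2 Hc]]] := @perpt_window N m (b + h%:Z) (M + M).+1 N0; last first.
  exists (c - b - (M + h)%:Z) => i ih; rewrite -Hc//.
  have cb : 0 <= c - b by rewrite /h in c1 c2 *; lia.
  have -> : c - b - (M + h)%:Z + i%:Z = - (M + h)%:Z + (absz (c - b)%R + i)%N%:Z.
    by lia.
  rewrite H; last by rewrite /h in c2 *; lia.
  by congr (perpt m _); lia.
exfalso; have [k kh kE] := perpt_modz n (b + h%:Z + M%:Z).
have := jP (n, k) nN; have := jM n k nN kh; set i := j (n, k) => iM /= /eqP; apply.
have iM0 : 0 <= i + M%:Z by lia.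
have -> : y i = y (- (M + h)%:Z + (absz (i + M%:Z)%R + h)%N%:Z).
  by congr y; lia.
rewrite H; last by lia.
rewrite -kE; have -> : b + (absz (i + M%:Z)%R + h)%N%:Z = b + h%:Z + (absz (i + M%:Z))%:Z.
  by rewrite PoszD; lia.
rewrite Hn; last by lia.
by congr (perpt n _); lia.
Qed.

(* [perpt m.+2] starts with a one and contains a run of [height m.+1] zeros, which
   no period [d <= height m.+1] can jump over. *)
Lemma perpt_aperiodic m (y : Cantor) (c : int) (d : nat) : (0 < d <= height m.+1)%N ->
  (forall i : nat, (i < height m.+2)%N -> y (c + i%:Z) = perpt m.+2 i%:Z) ->
  shiftn d%:Z y <> y.
Proof.
move=> /andP[d0 dh] yx yd.
have hle : (2 * height m.+1 < height m.+2)%N.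
  by rewrite heightSS mulnC ltn_mul2l height_gt0/=; have := ratio_gt m; lia.
have h0 := height_gt0 m.+1.
have yc : y c.
  have := yx 0%N; rewrite addr0 => ->; last by lia.
  have [+ _] := @desc_end 1 m.+2 0 isT isT.
  by rewrite mul0r /perpt => ->.
have ys (s : nat) : y (c + s%:Z * d%:Z).
  elim: s => [|s IH]; first by rewrite mul0r addr0.
  have -> : c + s.+1%:Z * d%:Z = (c + s%:Z * d%:Z) + d%:Z by lia.
  by move/(congr1 (fun z : Cantor => z (c + s%:Z * d%:Z))) : yd; rewrite /shiftn => ->.
have := ys ((height m.+1).-1 %/ d).+1.
have e1 := divn_eq (height m.+1).-1 d.
have e2 := ltn_pmod (height m.+1).-1 d0.
set q := ((height m.+1).-1 %/ d)%N in e1 *.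
have i1 : (height m.+1 <= q.+1 * d)%N by lia.
have i2 : (q.+1 * d < 2 * height m.+1)%N by lia.
rewrite -PoszM yx; last by lia.
by rewrite (@perpt_block 0)//=; lia.
Qed.

(** * The subshift is chaotic almost minimal *)

Lemma nbhs_cylinder (y : Cantor) (U : set Cantor) : nbhs y U ->
  exists l : nat, forall z : Cantor,
    (forall i : int, (absz i <= l)%N -> z i = y i) -> U z.
Proof.
move=> yU; apply: contrapT => H.
have [z zP] : {z : nat -> Cantor & forall l,
    (forall i : int, (absz i <= l)%N -> z l i = y i) /\ ~ U (z l)}.
  apply: (@boolp.choice _ _ (fun l (z : Cantor) =>
    (forall i : int, (absz i <= l)%N -> z i = y i) /\ ~ U z)) => l.
  apply: contrapT => H2; apply: H; exists l => z zy.
  by apply: contrapT => Uz; apply: H2; exists z.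
have zy : z @ \oo --> y.
  apply/cvg_sup => i; apply/cvg_image.
    by rewrite eqEsubset; split=> v // _; exists (fun=> v).
  move=> W Wy; exists ((fun x : Cantor => x i) @^-1` W).
    exists (absz i) => // l /= il; have [+ _] := zP l.
    by move=> /(_ i il) ->; exact: nbhs_singleton.
  rewrite eqEsubset; split; first by move=> _ [x Wx <-].
  by move=> w Ww; exists (fun=> w).
have /filter_ex[l Ul] : \forall l \near \oo, U (z l) by exact: (zy U yU).
by have [_] := zP l; apply.
Qed.

Lemma coordinate_continuous (i : int) : continuous (fun x : Cantor => x i).
Proof. by move=> x; exact: (@proj_continuous int (fun=> bool) i x). Qed.

Lemma open_coordinate (i : int) (b : bool) : open [set x : Cantor | x i = b].
Proof.
rewrite -[X in open X]/((fun x : Cantor => x i) @^-1` [set b]).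
apply: open_comp; first by move=> x _; exact: coordinate_continuous.
exact: discrete_open.
Qed.

Lemma nbhs_window (y : Cantor) (a : int) (l : nat) :
  nbhs y [set z : Cantor | forall i : nat, (i < l)%N -> z (a + i%:Z) = y (a + i%:Z)].
Proof.
elim: l => [|l IH]; first by apply: filterS filterT.
have H := open_nbhs_nbhs (conj (open_coordinate (a + l%:Z) (y (a + l%:Z))) (erefl _)).
apply: filterS (filterI IH H) => z [/= z1 z2] i.
by rewrite ltnS leq_eqVlt => /orP[/eqP ->//|]; exact: z1.
Qed.

Lemma closed_window (A : set Cantor) : closed A <->
  forall y : Cantor, (forall a (l : nat), exists2 z : Cantor, A z &
    forall i : nat, (i < l)%N -> z (a + i%:Z) = y (a + i%:Z)) -> A y.
Proof.
split=> [cA y H|H y cy].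
  apply: cA => U /nbhs_cylinder[l lU].
  have [z Az zy] := H (- l%:Z) (l + l).+1; exists z; split => //; apply: lU => i il.
  have -> : i = - l%:Z + (absz (i + l%:Z))%:Z by lia.
  by apply: zy; lia.
apply: H => a l; have [z [Az /= zy]] := cy _ (nbhs_window y a l).
by exists z.
Qed.

Lemma closed_orbit_closure : closed orbit_closure.
Proof.
apply/closed_window => y H a l; have [z Xz zy] := H a l.
have [n [b zb]] := Xz a l; exists n, b => i il; by rewrite -zy// zb.
Qed.

Lemma subshift_orbit_closure : subshift orbit_closure.
Proof.
split; first exact: closed_orbit_closure.
rewrite (_ : Defs.shift = shiftn 1)// eqEsubset; split => [|y Xy].
  by move=> _ [y Xy <-]; exact: orbit_closure_shift.
by exists (shiftn (-1) y); [exact: orbit_closure_shift|rewrite shiftnD subrr shiftn0].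
Qed.

Lemma orbit_closure_large y a (l : nat) : orbit_closure y -> exists M, forall N, (M <= N)%N ->
  exists b : int, [/\ 0 <= b, b + l%:Z <= (height N)%:Z &
    forall i : nat, (i < l)%N -> y (a + i%:Z) = perpt N (b + i%:Z)].
Proof.
move=> /(_ a l)[n [b yb]]; have [M MP] := perpt_appear n b l; exists M => N MN.
have [c [c0 c1 cE]] := MP _ MN; exists c; split => // i il.
by rewrite yb// cE.
Qed.

Lemma orbit_closure_transitive : top_transitive orbit_closure.
Proof.
move=> _ _ [U [oU ->]] [V [oV ->]] [y [Xy Uy]] [z [Xz Vz]].
have [l lU] := nbhs_cylinder (open_nbhs_nbhs (conj oU Uy)).
have [k kV] := nbhs_cylinder (open_nbhs_nbhs (conj oV Vz)).
have [M MP] := orbit_closure_large (- l%:Z) (l + l).+1 Xy.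
have [K KP] := orbit_closure_large (- k%:Z) (k + k).+1 Xz.
have [b [_ _ bP]] := MP _ (leq_maxl M K).
have [c [_ _ cP]] := KP _ (leq_maxr M K).
exists (c + k%:Z - (b + l%:Z)), (shiftn (c + k%:Z) (perpt (maxn M K))); split.
  exists (shiftn (b + l%:Z) (perpt (maxn M K))); last by rewrite shiftnD subrK.
  split; first exact: orbit_closure_perpt.
  apply: lU => i il; have -> : i = - l%:Z + (absz (i + l%:Z))%:Z by lia.
  by rewrite bP; [rewrite /shiftn; congr perpt; lia|lia].
split; first exact: orbit_closure_perpt.
apply: kV => i il; have -> : i = - k%:Z + (absz (i + k%:Z))%:Z by lia.
by rewrite cP; [rewrite /shiftn; congr perpt; lia|lia].
Qed.

Lemma orbit_closure_faithful : faithful_on orbit_closure.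
Proof.
move=> k kX; apply/eqP/negPn/negP => k0.
have H := @perpt_aperiodic (absz k) (perpt (absz k).+2) 0 (absz k).
apply: H => //.
  by rewrite lt0n absz_eq0 k0/= ltnW// (leq_trans (ltn_height _))// leq_height.
have xk : shiftn k (perpt (absz k).+2) = perpt (absz k).+2.
  by apply: kX; rewrite -[perpt _]shiftn0; exact: orbit_closure_perpt.
have [kp|kn] := leP 0 k; first by rewrite gez0_abs.
by rewrite ltz0_abs// -{1}xk shiftnD addNr shiftn0.
Qed.

Lemma periodic_perpt n k : Defs.periodic (shiftn k (perpt n)).
Proof.
apply: (@sub_finite_set _ _
  ((fun j : nat => shiftn j%:Z (perpt n)) @` `I_(height n))); last first.
  by apply: finite_image; exact: finite_II.
move=> _ [j _ <-]; have [i ih iE] := perpt_modz n (j + k).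
by exists i => //; rewrite shiftnD; apply/funext => t; rewrite /shiftn iE.
Qed.

Lemma orbit_closure_periodic_dense :
  orbit_closure `<=` closure (orbit_closure `&` Defs.periodic).
Proof.
move=> y Xy U /nbhs_cylinder[l lU].
have [n [b yb]] := Xy (- l%:Z) (l + l).+1.
exists (shiftn (b + l%:Z) (perpt n)); split.
  by split; [exact: orbit_closure_perpt|exact: periodic_perpt].
apply: lU => i il; have -> : i = - l%:Z + (absz (i + l%:Z))%:Z by lia.
by rewrite yb; [rewrite /shiftn; congr perpt; lia|lia].
Qed.

Lemma orbit_closure_almost_minimal (A : set Cantor) :
  A `<=` orbit_closure -> A <> orbit_closure ->
  closed A -> invariant_set A -> finite_set A.
Proof.
move=> AX AneqX /closed_window cA invA; apply: contrapT => infA; apply: AneqX.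
rewrite eqEsubset; split => // y Xy; apply: cA => a l.
have [M MP] := orbit_closure_large a l Xy.
have [z [Az zM]] : exists z, A z /\
    forall n k, (n < M.+1)%N -> z <> shiftn k (perpt n).
  apply: contrapT => H; apply: infA.
  apply: (@sub_finite_set _ _
    (\bigcup_(n < M.+1) range (fun k : int => shiftn k (perpt n)))).
    move=> z Az; apply: contrapT => Hz; apply: H; exists z; split => // n k nM zE.
    by apply: Hz; exists n => //; exists k.
  apply: bigcup_finite; first exact: finite_II.
  move=> n _; have := periodic_perpt n 0; apply: sub_finite_set => _ [k _ <-].
  by exists k => //; rewrite shiftn0.
have M0 : (0 < M.+1)%N by [].
have [c cP] := orbit_closure_contains (AX _ Az) M0 zM.
have [b [b0 bl bP]] := MP M.+1 (leqnSn M).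
exists (shiftn (c + b - a) z); first by apply: invA; exists z.
move=> i il; rewrite bP// /shiftn.
have -> : a + i%:Z + (c + b - a) = c + (absz b + i)%N%:Z by lia.
by rewrite cP; [congr perpt; lia|lia].
Qed.

Lemma CAM_orbit_closure : CAM orbit_closure.
Proof.
split; first by split; [exact: orbit_closure_transitive|exact: orbit_closure_faithful].
- exact: orbit_closure_periodic_dense.
- exact: orbit_closure_almost_minimal.
Qed.

(** * Haar measure on the dyadic odometer *)

Fixpoint binval (k : nat) (w : nat -> bool) : nat :=
  if k is k'.+1 then (binval k' w + w k' * 2 ^ k')%N else 0%N.

Lemma binval_lt k w : (binval k w < 2 ^ k)%N.
Proof. by elim: k => //= k IH; rewrite expnS; case: (w k); lia. Qed.

Lemma binvalS_mod k w : (binval k.+1 w %% 2 ^ k = binval k w)%N.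
Proof. by rewrite /= addnC modnMDl modn_small// binval_lt. Qed.

Lemma binval_mod k l w : (k <= l)%N -> (binval l w %% 2 ^ k = binval k w)%N.
Proof.
move=> /subnKC <-; elim: (l - k)%N => [|n IH]; first by rewrite addn0 modn_small// binval_lt.
by rewrite addnS -IH -(binvalS_mod (k + n)) modn_dvdm// dvdn_exp2l// leq_addr.
Qed.

Definition odo_cylinder : set (set (nat -> bool)) :=
  [set A | A = set0 \/ exists k r, A = [set w | binval k w = r]].

Definition Odo := g_sigma_algebraType odo_cylinder.

Lemma odo_cylinder_setI : setI_closed odo_cylinder.
Proof.
move=> A B [->|[k [r ->]]]; first by rewrite set0I; left.
move=> [->|[l [s ->]]]; first by rewrite setI0; left.
wlog kl : k l r s / (k <= l)%N.
  by move=> H; have [/H//|/ltnW/H] := leqP k l; rewrite setIC.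
have [sr|sr] := eqVneq (s %% 2 ^ k)%N r; [right; exists l, s|left].
  rewrite eqEsubset; split => w /=; first by case.
  by move=> ws; split => //; rewrite -(binval_mod w kl) ws.
rewrite eqEsubset; split => w //= [wr ws].
by move/eqP: sr; apply; rewrite -ws binval_mod.
Qed.

Lemma measurable_binval (k : nat) (Q : nat -> Prop) :
  measurable ([set w | Q (binval k w)] : set Odo).
Proof.
rewrite (_ : [set w | _] = \bigcup_(r in [set r | Q r]) [set w | binval k w = r]).
  apply: bigcup_measurable => r _; apply: sub_sigma_algebra.
  by right; exists k, r.
rewrite eqEsubset; split => w /=; first by move=> Qw; exists (binval k w).
by move=> [r Qr /= ->].
Qed.

Definition odometer (w : Odo) : Odo :=
  fun j => w j (+) (binval j w == (2 ^ j).-1).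

Lemma binval_odometer k w : binval k (odometer w) = ((binval k w).+1 %% 2 ^ k)%N.
Proof.
elim: k => [|k IH]; first by rewrite modn1.
rewrite /= IH /odometer; have lt := binval_lt k w; have k0 : (0 < 2 ^ k)%N by rewrite expn_gt0.
rewrite expnS; case: eqP => [->|ne].
  rewrite prednK// modnn; case: (w k) => /=.
    by rewrite (_ : (_.-1 + _).+1 = 2 * 2 ^ k)%N ?modnn//; lia.
  by rewrite modn_small; lia.
rewrite modn_small; last by lia.
by rewrite addbF modn_small; case: (w k); lia.
Qed.

Lemma measurable_odometer : measurable_fun setT odometer.
Proof.
apply: (@measurability _ _ Odo Odo setT odometer odo_cylinder) => //.
move=> _ [B [->|[k [r ->]]] <-]; first by rewrite preimage_set0 setI0.
rewrite setTI (_ : _ @^-1` _ = [set w | ((binval k w).+1 %% 2 ^ k)%N = r]).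
  exact: (measurable_binval k (fun v => (v.+1 %% 2 ^ k)%N = r)).
by rewrite eqEsubset; split => w /=; rewrite binval_odometer.
Qed.

Definition doubling (R : realType) (u : R) : R :=
  if u < 2^-1 then 2 * u else 2 * u - 1.

Definition digits (R : realType) (u : R) : Odo :=
  fun k => (0 <= u < 1) && (2^-1 <= iter k (@doubling R) u).

Lemma digits_interval (R : realType) (k r : nat) : (r < 2 ^ k)%N ->
  exists s : nat, [/\ (s < 2 ^ k)%N,
    forall u : R, (0 <= u < 1 /\ binval k (digits u) = r) <->
      s%:R <= 2 ^+ k * u < s%:R + 1 &
    forall u : R, s%:R <= 2 ^+ k * u < s%:R + 1 ->
      iter k (@doubling R) u = 2 ^+ k * u - s%:R].
Proof.
elim: k r => [|k IH] r rk.
  exists 0%N; split => // u; last by rewrite expr0 mul1r subr0.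
  by rewrite expr0 mul1r add0r; split => [[]//|->]; split => //=; move: rk; rewrite expn0; lia.
have [s [sk sE sT]] := IH (r %% 2 ^ k)%N (ltn_pmod _ (expn_gt0 2 k)).
have [b rE] : exists b : bool, r = (r %% 2 ^ k + b * 2 ^ k)%N.
  exists (2 ^ k <= r)%N; rewrite {1}(divn_eq r (2 ^ k)) addnC; congr (_ + _ * _)%N.
  have k0 : (0 < 2 ^ k)%N by rewrite expn_gt0.
  rewrite expnS in rk; case: leqP => rk2 /=; last by rewrite divn_small.
  by apply/eqP; rewrite eqn_leq divn_gt0// rk2 andbT -ltnS ltn_divLR//; lia.
have valb (u : R) : binval k.+1 (digits u) = r <->
    binval k (digits u) = (r %% 2 ^ k)%N /\ digits u k = b.
  rewrite {1}rE /=; clear rE; have := binval_lt k (digits u).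
  have := ltn_pmod r (expn_gt0 2 k).
  move: (binval k _) (r %% _)%N => v x; case: (digits u k); case: (b) => /=; lia.
clear rE; exists (2 * s + b)%N; split.
- by rewrite expnS; case: (b); lia.
- move=> u; rewrite valb; split.
    move=> [u01 [/(conj u01)/sE us ub]]; move: (sT _ us) ub.
    rewrite /digits u01/= => ->; rewrite exprS natrD natrM.
    case/andP: us => ? ?; case: (b) => /= [|/negbT]; rewrite -?ltNge => ?;
    by apply/andP; split; lra.
  move=> us; have us' : s%:R <= 2 ^+ k * u < s%:R + 1.
    move: us; rewrite exprS natrD natrM.
    by case: (b) => /= /andP[? ?]; apply/andP; split; lra.
  have [u01 ur] := (sE u).2 us'; split => //; split => //.
  rewrite /digits u01/= sT//; move: us; rewrite exprS natrD natrM.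
  case: (b) => /= /andP[? ?]; first by apply/idP; lra.
  by apply/negbTE; rewrite -ltNge; lra.
- move=> u us; have us' : s%:R <= 2 ^+ k * u < s%:R + 1.
    move: us; rewrite exprS natrD natrM.
    by case: (b) => /= /andP[? ?]; apply/andP; split; lra.
  rewrite iterS sT// /doubling; move: us; rewrite exprS natrD natrM.
  by case: (b) => /= /andP[? ?]; case: ltP => ?; lra.
Qed.

Lemma measurable_digits (R : realType) :
  measurable_fun setT (@digits R : measurableTypeR R -> Odo).
Proof.
apply: (@measurability _ _ (measurableTypeR R) Odo setT (@digits R) odo_cylinder) => //.
move=> _ [B [->|[k [r ->]]] <-]; first by rewrite preimage_set0 setI0.
rewrite setTI; have [rk|rk] := ltnP r (2 ^ k); last first.
  rewrite (_ : _ @^-1` _ = set0)// eqEsubset; split => u //= ur.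
  by have := binval_lt k (digits u); rewrite ur ltnNge rk.
have [s [_ sE _]] := digits_interval R rk.
pose I := `[s%:R / 2 ^+ k, (s%:R + 1) / 2 ^+ k[%classic : set R.
have k0 : 0 < 2 ^+ k :> R by rewrite exprn_gt0.
have IE u : I u <-> s%:R <= 2 ^+ k * u < s%:R + 1.
  by rewrite /I /= in_itv/= ler_pdivrMr// ltr_pdivlMr// mulrC.
have mI : measurable I by exact: measurable_itv.
pose J := `[0, 1[%classic : set R.
have mJ : measurable J by exact: measurable_itv.
rewrite (_ : _ @^-1` _ = I `|` (~` J `&` [set _ | r = 0%N])).
  apply: measurableU => //; apply: measurableI; first exact: measurableC.
  have [->|r0] := eqVneq r 0%N.
    by rewrite (_ : [set _ | _] = setT)//; apply/seteqP; split.
  rewrite (_ : [set _ | _] = set0)//; apply/seteqP; split => // ? /= /eqP.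
  by rewrite (negbTE r0).
have JE u : J u = (0 <= u < 1) by rewrite /J /= in_itv.
have nJ u : ~ J u -> binval k (digits u) = 0%N.
  rewrite JE => /negP uJ.
  have dE : forall j, digits u j = false by rewrite /digits (negbTE uJ).
  by elim: (k) => //= j ->; rewrite dE.
apply/seteqP; split => u /=.
  have [Ju|Ju] := pselect (J u); last by move=> ur; right; split => //; rewrite -ur nJ.
  by move=> ur; left; apply/IE/sE; split => //; rewrite -JE.
by case=> [/IE/sE[]//|[/nJ -> ->]].
Qed.

Definition digits_mfun (R : realType) : {mfun measurableTypeR R >-> Odo} :=
  HB.pack (@digits R : measurableTypeR R -> Odo)
    (isMeasurableFun.Build _ _ _ _ _ (@measurable_digits R)).

Definition unit_lebesgue (R : realType) :=
  mrestr (@lebesgue_measure R) (measurable_itv `[0 : R, 1[).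

HB.instance Definition _ (R : realType) := Measure.on (@unit_lebesgue R).

Lemma unit_lebesgue_setT (R : realType) : @unit_lebesgue R setT = 1%E.
Proof.
by rewrite /unit_lebesgue /mrestr setTI lebesgue_measure_itv/= lte_fin ltr01 oppr0 adde0.
Qed.

HB.instance Definition _ (R : realType) :=
  Measure_isProbability.Build _ _ _ (@unit_lebesgue R) (@unit_lebesgue_setT R).

Definition haar (R : realType) : probability Odo R :=
  distribution (@unit_lebesgue R) (digits_mfun R).

Lemma haar_binval (R : realType) (k r : nat) : (r < 2 ^ k)%N ->
  haar R [set w | binval k w = r] = ((2 ^+ k)^-1)%:E.
Proof.
move=> rk; have [s [_ sE _]] := digits_interval R rk.
have k0 : 0 < 2 ^+ k :> R by rewrite exprn_gt0.
rewrite /haar /distribution /pushforward/= /unit_lebesgue /mrestr.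
rewrite (_ : _ `&` _ = `[s%:R / 2 ^+ k, (s%:R + 1) / 2 ^+ k[%classic); last first.
  rewrite eqEsubset; split => u /=; rewrite !in_itv/= ler_pdivrMr// ltr_pdivlMr// (mulrC u).
    by case=> ur u01; apply/sE.
  by move=> /sE[].
rewrite lebesgue_measure_itv/= lte_fin ltr_pM2r ?invr_gt0// ltrDl ltr01.
by rewrite -EFinD -mulrBl addrAC subrr add0r mul1r.
Qed.

Lemma odo_measure_unique (R : realType) (m1 m2 : {measure set Odo -> \bar R}) :
  (m1 setT < +oo)%E ->
  (forall k r, (r < 2 ^ k)%N ->
     m1 [set w | binval k w = r] = m2 [set w | binval k w = r]) ->
  forall A : set Odo, measurable A -> m1 A = m2 A.
Proof.
move=> foo H; apply: (@measure_unique _ _ Odo odo_cylinder (fun=> setT)) => //.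
- exact: odo_cylinder_setI.
- by move=> _; right; exists 0%N, 0%N; apply/seteqP; split.
- by rewrite bigcup_const//; exists 0%N.
- move=> _ [->|[k [r ->]]]; first by rewrite !measure0.
  have [rk|rk] := ltnP r (2 ^ k); first exact: H.
  rewrite (_ : [set w | _] = set0) ?measure0// eqEsubset; split => // w /= wr.
  by have := binval_lt k w; rewrite wr ltnNge rk.
Qed.

Lemma haar_odometer (R : realType) (A : set Odo) : measurable A ->
  haar R (odometer @^-1` A) = haar R A.
Proof.
move=> mA.
pose odo : {mfun Odo >-> Odo} := HB.pack odometer
  (isMeasurableFun.Build _ _ _ _ odometer measurable_odometer).
apply: (@odo_measure_unique R (distribution (haar R) odo) (haar R)) => //.
  exact: fin_num_fun_lty.
move=> k r rk; rewrite [RHS]haar_binval//.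
have k0 : (0 < 2 ^ k)%N by rewrite expn_gt0.
rewrite -(@haar_binval R k ((r + (2 ^ k).-1) %% 2 ^ k)) ?ltn_pmod//.
congr (haar R _).
apply/seteqP; split => w /=; rewrite binval_odometer; have lt := binval_lt k w.
  move=> <-; rewrite modnDml.
  by rewrite (_ : (_ + _ = binval k w + 2 ^ k)%N) ?modnDr ?modn_small//; lia.
by move=> ->; rewrite -addn1 modnDml -addnA addn1 prednK// modnDr modn_small.
Qed.

Lemma haar_invariant_binval (R : realType) (B : set Odo) (k r : nat) :
  measurable B -> odometer @^-1` B = B -> (r < 2 ^ k)%N ->
  haar R (B `&` [set w | binval k w = r]) = (haar R B * ((2 ^+ k)^-1)%:E)%E.
Proof.
move=> mB invB rk; have mV s := measurable_binval k (fun v => v = s).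
have mBV s : measurable (B `&` [set w : Odo | binval k w = s]) by exact: measurableI.
have step s : (s < 2 ^ k)%N ->
    haar R (B `&` [set w | binval k w = s]) = haar R (B `&` [set w | binval k w = 0%N]).
  elim: s => // s IH sk; rewrite -IH; last by lia.
  rewrite -[LHS]haar_odometer//; congr (haar R _).
  rewrite preimage_setI invB; congr (_ `&` _); apply/seteqP.
  split => w /=; rewrite binval_odometer; have := binval_lt k w.
    rewrite leq_eqVlt => /orP[/eqP ->|lt]; first by rewrite modnn.
    by rewrite modn_small// => -[].
  by move=> _ ->; rewrite modn_small.
have BE : haar R B = (\sum_(s < 2 ^ k) haar R (B `&` [set w | binval k w = s]))%E.
  have tI : trivIset setT (fun s => B `&` [set w : Odo | binval k w = s]).
    apply/trivIsetP => i j _ _ /eqP ij; apply/seteqP; split => // w /= [[_ wi] [_ wj]].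
    by apply: ij; rewrite -wi.
  rewrite -(@measure_bigsetU _ _ _ (haar R) (fun s => B `&` [set w | binval k w = s]))//.
  congr (haar R _).
  rewrite -(bigcup_mkord _ (fun s => B `&` [set w | binval k w = s])).
  rewrite -setI_bigcupr.
  rewrite (_ : \bigcup_(i < _) _ = setT) ?setIT//; apply/seteqP.
  by split => // w _; exists (binval k w) => //=; exact: binval_lt.
rewrite BE (eq_bigr (fun=> haar R (B `&` [set w | binval k w = r]))); last first.
  by move=> s _; rewrite step// [RHS]step.
have [c cE] : exists c, haar R (B `&` [set w | binval k w = r]) = c%:E.
  by exists (fine (haar R (B `&` [set w | binval k w = r]))); rewrite fineK// fin_num_measure.
rewrite cE sumEFin sumr_const card_ord -EFinM; congr EFin.
by rewrite -(mulr_natr c) natrX mulfK// gt_eqF// exprn_gt0.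
Qed.

Lemma haar_ergodic (R : realType) (B : set Odo) : measurable B ->
  odometer @^-1` B = B -> haar R B = 0%E \/ haar R B = 1%E.
Proof.
move=> mB invB.
have [c cE] : exists c : R, haar R B = c%:E.
  by exists (fine (haar R B)); rewrite fineK// fin_num_measure.
have c0 : 0 <= c by rewrite -lee_fin -cE measure_ge0.
have : mrestr (haar R) mB B = mscale (NngNum c0) (haar R) B.
  apply: odo_measure_unique => //; first by have := ltry c; rewrite -cE -{1}(setTI B).
  move=> k r rk; change (haar R ([set w | binval k w = r] `&` B) =
    (c%:E * haar R [set w | binval k w = r])%E); rewrite setIC haar_invariant_binval//.
  by rewrite cE haar_binval.
change (haar R (B `&` B) = (c%:E * haar R B)%E -> haar R B = 0%E \/ haar R B = 1%E).
rewrite setIid cE -EFinM => /eqP.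
rewrite eqe -subr_eq0 -{1}(mulr1 c) -mulrBr mulf_eq0.
by case/orP => [/eqP ->|]; [left|rewrite subr_eq0 => /eqP <-; right].
Qed.

(** * The equivariant limit maps *)

Definition phase (m : nat) (w : Odo) : nat := binval (m.+1 ^ 2) w.

Lemma phase_lt m w : (phase m w < height m)%N. Proof. exact: binval_lt. Qed.

Lemma phase_mod n m w : (n <= m)%N -> (phase m w %% height n)%N = phase n w.
Proof. by move=> nm; rewrite /phase binval_mod// leq_exp2r. Qed.

Lemma perpt_phase n m w i : (n <= m)%N ->
  perpt n ((phase m w)%:Z + i) = perpt n ((phase n w)%:Z + i).
Proof.
move=> nm; rewrite (divn_eq (phase m w) (height n)) phase_mod// PoszD PoszM.
by rewrite -addrA addrC perpt_period.
Qed.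

Lemma phase_odometer m w :
  phase m (odometer w) = ((phase m w).+1 %% height m)%N.
Proof. exact: binval_odometer. Qed.

Lemma perpt_phase_odometer m w i :
  perpt m ((phase m (odometer w))%:Z + i) = perpt m ((phase m w)%:Z + (i + 1)).
Proof.
rewrite phase_odometer.
rewrite -[LHS](@perpt_period _ m _ ((phase m w).+1 %/ height m)%N%:Z)//.
congr (perpt m _); have := divn_eq (phase m w).+1 (height m).
by move: (_ %/ _)%N (_ %% _)%N => q r; lia.
Qed.

Definition phi (b : nat) (w : Odo) : Cantor := fun i =>
  `[< exists N, forall n, (N <= n)%N ->
        perpt (b + n.*2) ((phase (b + n.*2) w)%:Z + i) >].

Lemma phi_odometer b w : phi b (odometer w) = Defs.shift (phi b w).
Proof.
apply/funext => i; rewrite /phi /Defs.shift; apply/asboolP/asboolP => -[N NP];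
  by exists N => n Nn; have := NP n Nn; rewrite perpt_phase_odometer.
Qed.

Definition bad (m : nat) (i : int) : set Odo :=
  [set w | letter m (digit m ((phase m.+2 w)%:Z + i)) != m].

Lemma measurable_bad m i : measurable (bad m i).
Proof. exact: (measurable_binval _ (fun v => letter m (digit m (v%:Z + i)) != m)). Qed.

Lemma notin_bad m i w : ~ bad m i w ->
  perpt m.+2 ((phase m.+2 w)%:Z + i) = perpt m ((phase m w)%:Z + i).
Proof.
by rewrite /bad/= => /negP/negPn/eqP lm; rewrite perptSS lm perpt_phase// leqW.
Qed.

Definition bad_tail (b N : nat) (i : int) : set Odo :=
  \bigcup_n bad (b + (N + n).*2) i.

Lemma measurable_bad_tail b N i : measurable (bad_tail b N i).
Proof. by apply: bigcup_measurable => n _; exact: measurable_bad. Qed.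

Lemma bad_tail_perpt b N i w n : ~ bad_tail b N i w ->
  perpt (b + (N + n).*2) ((phase (b + (N + n).*2) w)%:Z + i) =
  perpt (b + N.*2) ((phase (b + N.*2) w)%:Z + i).
Proof.
move=> nb; elim: n => [|n IH]; first by rewrite addn0.
rewrite -IH addnS doubleS !addnS notin_bad// => H.
by apply: nb; exists n.
Qed.

Lemma phi_bad_tail b N i w : ~ bad_tail b N i w ->
  phi b w i = perpt (b + N.*2) ((phase (b + N.*2) w)%:Z + i).
Proof.
move=> /bad_tail_perpt E; rewrite /phi; case xE: (perpt (b + N.*2) _).
  by apply/asboolP; exists N => n Nn; rewrite -(subnKC Nn) E xE.
apply/asboolP => -[M MP]; have := MP (N + M)%N (leq_addl _ _).
by rewrite E xE.
Qed.

Lemma digit_shift_height m v i k :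
  digit m (v + k * (height m.+2)%:Z + i) = digit m (v + i).
Proof.
have -> : v + k * (height m.+2)%:Z + i =
    (k * (ratio m)%:Z) * (height m.+1)%:Z + (v + i).
  by rewrite heightSS PoszM; lia.
apply/eqP; rewrite -eqz_nat !digitE divzMDl; last by rewrite eqz_nat -lt0n height_gt0.
by rewrite modzMDl.
Qed.

Lemma bad_odometer m i : odometer @^-1` bad m i = bad m (i + 1).
Proof.
apply/seteqP; suff H w : digit m ((phase m.+2 (odometer w))%:Z + i) =
    digit m ((phase m.+2 w)%:Z + (i + 1)) by split => w; rewrite /bad/= H.
rewrite phase_odometer.
rewrite -[LHS](@digit_shift_height m _ _ ((phase m.+2 w).+1 %/ height m.+2)%N%:Z).
congr (digit m _); have := divn_eq (phase m.+2 w).+1 (height m.+2).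
by move: (_ %/ _)%N (_ %% _)%N => q r; lia.
Qed.

Lemma letter_typical m t : (m.*2 < t)%N -> t != (ratio m).-1 -> letter m t = m.
Proof.
rewrite /letter => mt /negbTE ->; case: ifP => ot; last by rewrite leqNgt mt.
by lia.
Qed.

Lemma bad0_exceptional m w : bad m 0 w ->
  exists2 j, (j < (m.*2 + 2) * height m.+1)%N &
    phase m.+2 w = (if (j < m.*2.+1 * height m.+1)%N then j
                    else j - m.*2.+1 * height m.+1 + (ratio m).-1 * height m.+1)%N.
Proof.
set h := height m.+1; have h0 : (0 < h)%N := height_gt0 _.
have lt : (phase m.+2 w < h * ratio m)%N by rewrite -heightSS; exact: phase_lt.
have q0 := ratio_gt m.
have e1 := divn_eq (phase m.+2 w) h; have e2 := ltn_pmod (phase m.+2 w) h0.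
rewrite /bad/= addr0; set t := (phase m.+2 w %/ h)%N in e1.
have tq : (t < ratio m)%N by rewrite ltn_divLR// mulnC.
have -> : digit m (phase m.+2 w)%:Z = t.
  by apply/eqP; rewrite -eqz_nat digitE divz_nat modz_small.
have [tm _|mt] := leqP t m.*2.
  have le1 : (t * h <= m.*2 * h)%N by rewrite leq_mul2r tm orbT.
  by exists (phase m.+2 w); [|rewrite ifT]; rewrite ?mulnDl ?mulSn; lia.
have [tE _|tne] := eqVneq t (ratio m).-1; last by rewrite letter_typical ?eqxx.
exists (phase m.+2 w %% h + m.*2.+1 * h)%N; first by rewrite mulnDl mulSn; lia.
by rewrite ifF ?addnK; [rewrite {1}e1 tE addnC|lia].
Qed.

Lemma haar_bad0 (R : realType) m :
  (haar R (bad m 0) <= ((2 ^ (m + 4))%:R^-1)%:E)%E.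
Proof.
set h := height m.+1; pose f j := (if (j < m.*2.+1 * h)%N then j
  else j - m.*2.+1 * h + (ratio m).-1 * h)%N.
have h0 : (0 < h)%N := height_gt0 _; have q0 := ratio_gt m.
have fh j : (j < (m.*2 + 2) * h)%N -> (f j < height m.+2)%N.
  rewrite heightSS -/h /f; move: (m.*2) (ratio m) q0 => a q /subnKC <-.
  by move: (q - _)%N => e jh; case: ifP => H; lia.
pose F j : set Odo := [set w | phase m.+2 w = f j].
have mF j : measurable (F j) by exact: (measurable_binval _ (fun v => v = f j)).
have sub : bad m 0 `<=` \big[setU/set0]_(j < (m.*2 + 2) * h) F j.
  move=> w /bad0_exceptional[j jh wj]; rewrite -bigcup_mkord.
  by exists j.
apply: (le_trans (content_subadditive (haar R) _ (measurable_bad m 0) sub)) => //.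
rewrite (eq_bigr (fun=> ((height m.+2)%:R^-1)%:E)); last first.
  by move=> j _; rewrite [LHS]haar_binval ?natrX//; exact: fh.
rewrite sumEFin lee_fin sumr_const card_ord -(mulr_natl (_^-1)) ler_pdivrMr; last first.
  by rewrite ltr0n height_gt0.
rewrite mulrC ler_pdivlMr; last by rewrite ltr0n expn_gt0.
rewrite -natrM ler_nat heightSS -/h /ratio.
have m1 : (m + 1 <= 2 ^ m)%N by rewrite addn1 ltn_expl.
have -> : (m.*2 + 5 = m + (m + 4) + 1)%N by lia.
rewrite (mulnC _ h) -mulnA leq_mul2l; apply/orP; right.
rewrite !expnD expn1 mulnAC leq_mul2r; apply/orP; right; lia.
Qed.

Lemma haar_bad (R : realType) m i :
  (haar R (bad m i) <= ((2 ^ (m + 4))%:R^-1)%:E)%E.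
Proof.
have step j : haar R (bad m (j + 1)) = haar R (bad m j).
  by rewrite -bad_odometer haar_odometer//; exact: measurable_bad.
rewrite (_ : haar R (bad m i) = haar R (bad m 0)); first exact: haar_bad0.
have pos (n : nat) j : haar R (bad m (j + n%:Z)) = haar R (bad m j).
  elim: n => [|n IH]; first by rewrite addr0.
  by rewrite -IH -[RHS]step; congr (haar R (bad m _)); lia.
have [i0|i0] := leP 0 i; first by rewrite -[RHS](pos (absz i)) add0r gez0_abs.
by rewrite -[LHS](pos (absz i)) ltz0_abs// addrN.
Qed.

Lemma haar_bad_tail (R : realType) b N i :
  (haar R (bad_tail b N i) <= ((2 ^ (N + 3))%:R^-1)%:E)%E.
Proof.
have mF n := measurable_bad (b + (N + n).*2) i.
have := measure_sigma_subadditive (haar R) mF (measurable_bad_tail b N i) (@subset_refl _ _).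
move=> /le_trans; apply.
have e0 : 0 <= (2 ^ (N + 3))%:R^-1 :> R by rewrite invr_ge0.
refine (le_trans _ (epsilon_trick0 xpredT e0)).
apply: lee_nneseries => [n _ _|n _]; first exact: measure_ge0.
apply: (le_trans (haar_bad R _ i)); rewrite lee_fin -invfM -natrM -expnD.
rewrite lef_pV2 ?posrE ?ltr0n ?expn_gt0// ler_nat leq_exp2l//; lia.
Qed.

Lemma measurable_open_cantor (A : set Cantor) : open A -> measurable (A : set BorelCantor).
Proof. by move=> oA; exact: sub_sigma_algebra. Qed.

Lemma measurable_closed_cantor (A : set Cantor) :
  closed A -> measurable (A : set BorelCantor).
Proof.
move=> cA; rewrite -(setCK A); apply: (@measurableC _ BorelCantor).
by apply: measurable_open_cantor; exact: closed_openC.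
Qed.

Lemma measurable_fun_cantor d (T : measurableType d) (f : T -> BorelCantor) :
  (forall i b, measurable [set t | f t i = b]) -> measurable_fun setT f.
Proof.
move=> mf; apply: (@measurability _ _ T BorelCantor setT f (@open Cantor)) => //.
move=> _ [B oB <-]; rewrite setTI.
pose C (p : nat * seq bool) : set Cantor := [set y |
  forall k, (k < p.1 + p.1.+1)%N -> y (k%:Z - p.1%:Z) = nth false p.2 k].
rewrite (_ : f @^-1` B = \bigcup_p (f @^-1` [set y | C p y /\ C p `<=` B])).
  apply: countable_bigcupT_measurable => // p.
  have [CB|CB] := pselect (C p `<=` B); last first.
    rewrite (_ : f @^-1` _ = set0); first exact: measurable0.
    by apply/seteqP; split => // t [].
  rewrite (_ : f @^-1` _ = \bigcap_(k in `I_(p.1 + p.1.+1))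
      [set t | f t (k%:Z - p.1%:Z) = nth false p.2 k]).
    by apply: bigcap_measurable => [|k _]; [exists 0%N; rewrite /= addnS|exact: mf].
  by apply/seteqP; split => t => [[Ct _] k kp|Ct]; [exact: Ct|split => // k kp; exact: Ct].
apply/seteqP; split => t /=; last by move=> [p _ [Cp CB]]; exact: CB.
move=> Bt; have [l lB] := nbhs_cylinder (open_nbhs_nbhs (conj oB Bt)).
exists (l, mkseq (fun k => f t (k%:Z - l%:Z)) (l + l.+1)) => //; split => /=.
  by move=> k kl; rewrite nth_mkseq.
move=> y Cy; apply: lB => i il; have -> : i = (absz (i + l%:Z))%:Z - l%:Z by lia.
by rewrite Cy ?nth_mkseq//=; lia.
Qed.

Lemma measurable_phi b : measurable_fun setT (phi b : Odo -> BorelCantor).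
Proof.
apply: measurable_fun_cantor => i c.
have mT : measurable [set w | phi b w i].
  rewrite (_ : [set w | _] = \bigcup_N \bigcap_(n in [set n | (N <= n)%N])
      [set w : Odo | perpt (b + n.*2) ((phase (b + n.*2) w)%:Z + i)]).
    apply: bigcup_measurable => N _; apply: bigcap_measurable; first by exists N => /=.
    by move=> n _; exact: (measurable_binval _ (fun v => perpt (b + n.*2) (v%:Z + i))).
  apply/seteqP; split => w /=.
    by rewrite /phi => /asboolP[N NP]; exists N.
  by move=> [N _ NP]; apply/asboolP; exists N.
case: c => //; rewrite (_ : [set w | _] = ~` [set w | phi b w i]); last first.
  by apply/seteqP; split => w /= => [->//|/negP/negbTE].
exact: measurableC.
Qed.

Definition phi_mfun b : {mfun Odo >-> BorelCantor} :=
  HB.pack (phi b : Odo -> BorelCantor)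
    (isMeasurableFun.Build _ _ _ _ _ (measurable_phi b)).

Definition law (R : realType) b : probability BorelCantor R :=
  distribution (haar R) (phi_mfun b).

Lemma lawE (R : realType) b A : law R b A = haar R (phi b @^-1` A).
Proof. by []. Qed.

Lemma measurable_preimage_phi b (A : set BorelCantor) :
  measurable A -> measurable (phi b @^-1` A : set Odo).
Proof.
by move=> mA; rewrite -[X in measurable X]setTI; exact: (measurable_phi b).
Qed.

Lemma geometric_le0 (R : realType) (x : \bar R) :
  (forall N, (x <= ((2 ^ (N + 3))%:R^-1)%:E)%E) -> (x <= 0)%E.
Proof.
move=> H; case: x H => [c| |] H //; last by have := H 0%N.
rewrite lee_fin leNgt; apply/negP => c0.
pose n := Num.bound c^-1; have := H n; rewrite lee_fin leNgt => /negP; apply.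
rewrite invf_plt ?posrE ?ltr0n ?expn_gt0//.
have cn : c^-1 < n%:R by rewrite archi_boundP// invr_ge0 ltW.
apply: (lt_le_trans cn); rewrite ler_nat (leq_trans (ltnW (ltn_expl n (ltnSn 1))))//.
by rewrite leq_exp2l// leq_addr.
Qed.

Lemma bad_tail_le b N M i : (N <= M)%N -> bad_tail b M i `<=` bad_tail b N i.
Proof.
move=> NM w [n _ nb]; exists (M - N + n)%N => //.
by rewrite addnA subnKC.
Qed.

Lemma phi_orbit_closure b w :
  (forall i, exists N, ~ bad_tail b N i w) -> orbit_closure (phi b w).
Proof.
move=> H a l.
have [N NP] : exists N, forall i : nat, (i < l)%N -> ~ bad_tail b N (a + i%:Z) w.
  elim: l => [|l [N NP]]; first by exists 0%N.
  have [M MP] := H (a + l%:Z); exists (maxn N M) => i.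
  rewrite ltnS leq_eqVlt => /orP[/eqP ->|il].
    by move=> /(bad_tail_le (leq_maxr N M)).
  by move=> /(bad_tail_le (leq_maxl N M)); exact: NP.
exists (b + N.*2)%N, ((phase (b + N.*2) w)%:Z + a) => i il.
by rewrite (@phi_bad_tail b N) ?addrA//; exact: NP.
Qed.

Lemma law_orbit_closure (R : realType) b : law R b orbit_closure = 1%E.
Proof.
have mX : measurable (orbit_closure : set BorelCantor).
  by apply: measurable_closed_cantor; exact: closed_orbit_closure.
have mpX := measurable_preimage_phi b mX.
pose Z (i : int) := \bigcap_N bad_tail b N i.
have mZ i : measurable (Z i : set Odo).
  by apply: bigcapT_measurable => N; exact: measurable_bad_tail.
have Z0 i : haar R (Z i) = 0%E.
  apply/eqP; rewrite eq_le measure_ge0 andbT; apply: geometric_le0 => N.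
  apply: le_trans (haar_bad_tail R b N i); rewrite le_measure ?inE//.
    exact: measurable_bad_tail.
  by move=> w; apply.
have : (haar R).-negligible (\bigcup_k Z (odflt 0 (unpickle k))).
  apply: negligible_bigcup => k; exists (Z (odflt 0 (unpickle k))).
  by split; [exact: mZ|exact: Z0|exact: subset_refl].
move=> /(@negligibleS _ _ _ (haar R) _ (~` (phi b @^-1` orbit_closure))) => nX.
have : haar R (~` (phi b @^-1` orbit_closure)) = 0%E.
  apply: measure_negligible; first exact: measurableC.
  apply: nX => w Xw; apply: contrapT => H; apply: Xw; apply: phi_orbit_closure => i.
  apply: contrapT => Hi; apply: H; exists (pickle i) => //; rewrite pickleK/=.
  by move=> N _; apply: contrapT => nb; apply: Hi; exists N.
rewrite probability_setC// lawE.
have [c ->] : exists c : R, haar R (phi b @^-1` orbit_closure) = c%:E.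
  by exists (fine (haar R (phi b @^-1` orbit_closure))); rewrite fineK// fin_num_measure.
by rewrite -EFinB => -[/eqP]; rewrite subr_eq0 => /eqP <-.
Qed.

Lemma law_ergodic (R : realType) b : ergodic (law R b).
Proof.
have pS A : phi b @^-1` (Defs.shift @^-1` A) = odometer @^-1` (phi b @^-1` A).
  by apply/seteqP; split => w /=; rewrite phi_odometer.
split=> [A mA|A mA invA]; rewrite !lawE.
  by rewrite pS haar_odometer//; exact: measurable_preimage_phi.
apply: haar_ergodic; first exact: measurable_preimage_phi.
by rewrite -pS invA.
Qed.

Lemma bad_block m n j w : (n <= m.+1)%N ->
  (j < height n)%N -> bad m (j%:Z - (phase n w)%:Z) w -> bad m 0 w.
Proof.
move=> nm jn; rewrite /bad/=; have nm2 := leqW nm.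
suff -> : digit m ((phase m.+2 w)%:Z + (j%:Z - (phase n w)%:Z)) =
    digit m ((phase m.+2 w)%:Z + 0) by [].
apply: (digit_block nm); have h0 := height_gt0 n; have pn := phase_lt n w.
have := divn_eq (phase m.+2 w) (height n); rewrite phase_mod//.
by move: (_ %/ _)%N => q ->; rewrite !(@divz_range _ q%:Z)//; lia.
Qed.

Lemma phi_block b N w : ~ bad_tail b N 0 w ->
  forall j : nat, (j < height (b + N.*2))%N ->
    phi b w (- (phase (b + N.*2) w)%:Z + j%:Z) = perpt (b + N.*2) j%:Z.
Proof.
move=> nb j jh; rewrite (@phi_bad_tail b N); first by rewrite addNKr.
move=> [n _]; rewrite addrC => /bad_block H; apply: nb; exists n => //.
by apply: H => //; lia.
Qed.

Definition period_set (d : nat) : set Cantor := [set y | shiftn d%:Z y = y].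

Lemma measurable_period_set d : measurable (period_set d : set BorelCantor).
Proof.
apply: measurable_closed_cantor; apply/closed_window => y H; apply/funext => i.
have [z zd zy] := H i d.+1; rewrite /shiftn -zy//.
have := zy 0%N isT; rewrite !addr0 => <-.
by move/(congr1 (fun x : Cantor => x i)) : zd.
Qed.

Lemma haar_tail_lt1 (R : realType) b N i : (haar R (bad_tail b N i) < 2^-1%:E)%E.
Proof.
apply: (le_lt_trans (haar_bad_tail R b N i)); rewrite lte_fin.
rewrite ltf_pV2 ?posrE ?ltr0n ?expn_gt0// ltr_nat.
by rewrite (leq_trans _ (leq_pexp2l _ (leq_addl N 3))).
Qed.

Lemma law_period_set (R : realType) b d : (0 < d)%N -> law R b (period_set d) = 0%E.
Proof.
move=> d0; have mP := measurable_period_set d.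
have [_ /(_ _ mP)[|//|P1]] := law_ergodic R b.
  apply/seteqP; split => y /= yd.
    apply/funext => i; move/(congr1 (fun x : Cantor => x (i - 1))) : yd.
    by rewrite /shiftn /Defs.shift subrK (_ : i - 1 + d%:Z + 1 = i + d%:Z)//; lia.
  apply/funext => i; move/(congr1 (fun x : Cantor => x (i + 1))) : yd.
  by rewrite /shiftn /Defs.shift (_ : i + 1 + d%:Z = i + d%:Z + 1)//; lia.
have : (law R b (period_set d) <= haar R (bad_tail b d.+1 0))%E.
  rewrite lawE le_measure ?inE//; first exact: measurable_preimage_phi.
    exact: measurable_bad_tail.
  move=> w wd; apply: contrapT => /phi_block.
  rewrite doubleS !addnS => H; apply: (@perpt_aperiodic _ _ _ d _ H) => //.
  by rewrite d0/= ltnW// (leq_trans (ltn_height d))// leq_height//; lia.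
move=> /le_lt_trans/(_ (haar_tail_lt1 R _ _ _)); rewrite P1 lte_fin ltNge => /negP.
by case; lra.
Qed.

Lemma law_nonatomic (R : realType) b : nonatomic (law R b).
Proof.
move=> x; pose A (j : nat) : set BorelCantor := [set y : Cantor | shiftn j%:Z y = x].
have A0 : [set x] = A 0%N.
  by apply/seteqP; split => y /=; rewrite /A/= shiftn0.
have mA j : measurable (A j).
  apply: measurable_closed_cantor; apply/closed_window => y H; apply/funext => i.
  have [z zx zy] := H (i + j%:Z) 1%N; rewrite /shiftn.
  by have := zy 0%N isT; rewrite !addr0 => <-; rewrite -zx.
have muA j : law R b (A j) = law R b [set x].
  elim: j => [|j <-]; first by rewrite -A0.
  have [+ _] := law_ergodic R b; move=> /(_ _ (mA j)) <-; congr (law R b _).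
  apply/seteqP; split => y; rewrite /A/= => <-; apply/funext => i;
    by rewrite /shiftn /Defs.shift; congr y; lia.
apply: contrapT => /eqP x0.
have tA : trivIset setT A.
  suff disj i j : (i < j)%N -> A i `&` A j = set0.
    apply/trivIsetP => i j _ _; rewrite neq_ltn => /orP[/disj//|/disj].
    by rewrite setIC.
  move=> ij; apply/seteqP; split => // y [/= yi yj]; move/eqP: x0; apply.
  apply/eqP; rewrite eq_le measure_ge0 andbT.
  have d0 : (0 < j - i)%N by rewrite subn_gt0.
  rewrite -(law_period_set R b d0) le_measure ?inE//; first by rewrite A0.
    exact: measurable_period_set.
  move=> _ ->; rewrite /period_set/= -{1}yi shiftnD -yj; congr (shiftn _ y); lia.
have [c cE] : exists c : R, law R b [set x] = c%:E.
  exists (fine (law R b [set x])); rewrite fineK// fin_num_measure//.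
  by rewrite A0.
have c0 : 0 < c.
  by rewrite lt_neqAle eq_sym -lee_fin -cE measure_ge0 andbT; move: x0; rewrite cE.
pose n := Num.bound c^-1.
have : (law R b (\big[setU/set0]_(j < n) A j) <= 1)%E.
  by apply: probability_le1; apply: bigsetU_measurable.
rewrite (@measure_bigsetU _ _ _ (law R b) A)// (eq_bigr (fun=> c%:E)); last first.
  by move=> j _; exact: etrans (muA j) cE.
rewrite sumEFin lee_fin sumr_const card_ord -(mulr_natr c) -ler_pdivlMl// mulr1.
by rewrite leNgt archi_boundP// invr_ge0 ltW.
Qed.

Lemma phi0_bad_tail b w : (b <= 1)%N -> phi b w 0 <> odd b -> bad_tail b 0 0 w.
Proof.
move=> b1 H; apply: contrapT => nb; apply: H.
by rewrite (@phi_bad_tail b 0)// double0 addn0 /perpt desc_small.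
Qed.

Theorem theorem1p1 (R : realType) :
  exists X : set Cantor, subshift X /\ CAM X /\
    exists mu1 mu2 : probability BorelCantor R,
      [/\ supported_on mu1 X, supported_on mu2 X,
          ergodic mu1 /\ ergodic mu2, nonatomic mu1 /\ nonatomic mu2 &
          exists A : set BorelCantor, measurable A /\ mu1 A <> mu2 A].
Proof.
exists orbit_closure; split; first exact: subshift_orbit_closure.
split; first exact: CAM_orbit_closure.
exists (law R 0), (law R 1); split; [exact: law_orbit_closure|exact: law_orbit_closure|..].
- by split; exact: law_ergodic.
- by split; exact: law_nonatomic.
pose A (b : bool) : set BorelCantor := [set y : Cantor | y 0 = b].
have mA b : measurable (A b) by apply: measurable_open_cantor; exact: open_coordinate.
have small b : (b <= 1)%N -> (law R b (A (~~ odd b)) < 2^-1%:E)%E.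
  move=> b1; apply: le_lt_trans (haar_tail_lt1 R b 0 0).
  rewrite lawE le_measure ?inE//; first exact: measurable_preimage_phi.
    exact: measurable_bad_tail.
  move=> w /= wb; apply: phi0_bad_tail => //; rewrite wb.
  by case: (odd b).
exists (A true); split => // e.
have s0 : (law R 0 (A true) < 2^-1%:E)%E := small 0%N isT.
have s1 : (law R 1 (A false) < 2^-1%:E)%E := small 1%N isT.
move: s0 s1; rewrite e.
rewrite (_ : A false = ~` A true); last first.
  by apply/seteqP; split => y; rewrite /A/=; case: (y 0).
rewrite probability_setC//.
have [c ->] : exists c : R, law R 1 (A true) = c%:E.
  by exists (fine (law R 1 (A true))); rewrite fineK// fin_num_measure.
by rewrite -EFinB !lte_fin => ? ?; clear e; lra.
Qed.
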